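(* Let $r\geq 4$ and let $G$ be a graph on $n\geq 10^6r^4$ vertices with $\delta(G)\geq\left(1-\frac{1}{10^5r^2}\right)n$. Then $G$ has a fractional $K_r$-decomposition.
   Context: A fractional $K_r$-decomposition of $G$ is a function $\omega$ from the set of copies of $K_r$ in $G$ to $[0,1]$ such that for every edge $e$, the sum of $\omega(K)$ over the copies $K$ containing $e$ equals $1$. $\delta(G)$ is the minimum degree. *)

(* Defs.v *)
From HB Require Import structures.
From mathcomp Require Import all_boot all_order all_algebra.
From mathcomp Require Import reals.

Set Implicit Arguments.
Unset Strict Implicit.
Unset Printing Implicit Defensive.

Import Order.TTheory GRing.Theory Num.Theory.

Local Open Scope ring_scope.

Record sgraph := SGraph {
  vertex :> finType;
  adj : rel vertex;
  adj_sym : symmetric adj;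
  adj_irrefl : irreflexive adj
}.

Definition edges (G : sgraph) : {set {set G}} :=
  [set [set p.1; p.2] | p : G * G & adj p.1 p.2].

Definition degree (G : sgraph) (v : G) : nat := #|[set u : G | adj v u]|.

(* Every degree is at most #|G|, so the default value #|G| does not affect the
   minimum when G has a vertex. *)
Definition min_degree (G : sgraph) : nat :=
  \big[minn/#|G|]_(v : G) degree v.

(* A copy of K_r in G is a complete subgraph on r vertices; it is determined by
   its vertex set and is represented by it. Accordingly, a copy contains an edge
   e exactly when e, as a pair of vertices, is a subset of the copy. *)
Definition clique_copies (G : sgraph) (r : nat) : {set {set G}} :=
  [set K : {set G} |
    (#|K| == r) && [forall x in K, forall y in K, (x != y) ==> adj x y]].

(* Only the values of w on copies of K_r are relevant. *)
Definition fractional_clique_decomposition (R : realType) (G : sgraph)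
    (r : nat) (w : {set G} -> R) : Prop :=
  (forall K : {set G}, K \in clique_copies G r -> 0 <= w K <= 1) /\
  (forall e : {set G}, e \in edges G ->
     \sum_(K in clique_copies G r | e \subset K) w K = 1).

(* Main.v *)
Require Import Defs.
From mathcomp Require Import all_boot all_order all_algebra.
From mathcomp Require Import reals zify ring lra.

(* Write c_j for the number of j-cliques of G and k_j(e) for the number of those
   containing an edge e, and put j = r - 2. Deleting e, k_{j+2}(e) counts the
   j-cliques avoiding the set Z of non-neighbours of the ends of e, so by
   Bonferroni k_{j+2}(e)/c_j = 1 - |Z| c_{j-1}/c_j + O(r^2 delta^2), where
   c_{j-1}/c_j is close to j/n. The linear term doubles when j does; hence
   2 k_{j+2}(e)/c_j - k_{2j+2}(e)/c_{2j} is extremely close to 1. This number is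
   the sum at e of the weighting of the r-cliques K that combines a constant with
   the number of (2j+2)-cliques containing K, and that weighting stays of order
   1/c_j. The remaining error at each edge is removed exactly by signed gadgets
   supported on the (r+2)-cliques through the edge, whose total effect on any
   r-clique is smaller than its weight. *)

Set Implicit Arguments.
Unset Strict Implicit.
Unset Printing Implicit Defensive.

Import Order.TTheory GRing.Theory Num.Theory.
Local Open Scope ring_scope.

(** * Cliques containing a given set *)

Definition cliques_over (G : sgraph) (j : nat) (A : {set G}) : {set {set G}} :=
  [set K in clique_copies G j | A \subset K].

(** Since [adj] is irreflexive, [A] lies inside this set: avoiding it forces disjointness from [A],
    and each vertex counts as its own non-neighbour. *)
Definition nonneighbours (G : sgraph) (A : {set G}) : {set G} :=
  [set v | [exists x in A, ~~ adj x v]].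

Lemma clique_copiesP (G : sgraph) (j : nat) (K : {set G}) :
  reflect (#|K| = j /\ {in K &, forall x y, x != y -> adj x y})
    (K \in clique_copies G j).
Proof.
rewrite inE; apply: (iffP andP) => -[cK adjK].
  split; first exact/eqP.
  move=> x y xK yK neq_xy.
  by move/forall_inP: adjK => /(_ x xK)/forall_inP/(_ y yK)/implyP/(_ neq_xy).
split; first exact/eqP.
apply/forall_inP => x xK; apply/forall_inP => y yK.
by apply/implyP; apply: adjK.
Qed.

Lemma card_clique (G : sgraph) (j : nat) (K : {set G}) :
  K \in clique_copies G j -> #|K| = j.
Proof. by case/clique_copiesP. Qed.

Lemma clique_sub (G : sgraph) (j : nat) (K A : {set G}) :
  K \in clique_copies G j -> A \subset K -> A \in clique_copies G #|A|.
Proof.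
move=> /clique_copiesP[_ adjK] /subsetP sAK; apply/clique_copiesP; split => //.
by move=> x y xA yA; apply: adjK; apply: sAK.
Qed.

Lemma edges_clique (G : sgraph) : edges G = clique_copies G 2.
Proof.
apply/setP => e; apply/imsetP/idP.
- case=> -[x y] /=; rewrite inE /= => adj_xy ->.
  have neq_xy : x != y.
    by apply: contraTneq adj_xy => ->; rewrite adj_irrefl.
  apply/clique_copiesP; split; first by rewrite cards2 neq_xy.
  by move=> u v; rewrite !inE => /orP[]/eqP-> /orP[]/eqP->;
    rewrite ?eqxx // adj_sym.
- move=> eC; have [/eqP/cards2P[x [y [neq_xy ->]]] adjK] := elimT (clique_copiesP _ _) eC.
  by exists (x, y) => //=; rewrite inE /= adjK // !inE eqxx ?orbT.
Qed.

(** Removing [A] is injective on sets containing [A], and it leaves a clique on [j] vertices. *)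
Lemma card_cliques_over_le (G : sgraph) (j a : nat) (A : {set G}) :
  #|A| = a -> (#|cliques_over (j + a) A| <= #|clique_copies G j|)%N.
Proof.
move=> cA; rewrite -(@card_in_imset _ _ (fun T => T :\: A)).
- apply: subset_leq_card; apply/subsetP => _ /imsetP[T + ->].
  rewrite inE => /andP[TC sAT].
  have := clique_sub TC (subsetDl T A).
  by rewrite cardsDS // (card_clique TC) cA addnK.
- move=> S T; rewrite !inE => /andP[_ sAS] /andP[_ sAT] eqST.
  by rewrite -(setID S A) -(setID T A) eqST (setIidPr sAS) (setIidPr sAT).
Qed.

(** [S |-> S :|: A] is a bijection with inverse [T |-> T :\: A]: avoiding the non-neighbours of [A]
    means being disjoint from [A] and completely joined to it. *)
Lemma card_cliques_over (G : sgraph) (j a : nat) (A : {set G}) :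
  A \in clique_copies G a ->
  #|cliques_over (j + a) A| =
  #|[set S in clique_copies G j | [disjoint S & nonneighbours A]]|.
Proof.
move=> /clique_copiesP[cA adjA].
have disjA (S : {set G}) : [disjoint S & nonneighbours A] -> [disjoint S & A].
  move=> /disjointWr; apply; apply/subsetP => v vA.
  by rewrite inE; apply/exists_inP; exists v; rewrite ?adj_irrefl.
have joined (S : {set G}) : [disjoint S & nonneighbours A] ->
    {in A & S, forall x y, adj x y}.
  move=> dS x y xA yS; have /negbT := disjointFr dS yS.
  rewrite inE negb_exists => /forallP/(_ x).
  by rewrite xA negbK.
have decomp (S : {set G}) : [disjoint S & A] -> (S :|: A) :\: A = S.
  by move=> dS; rewrite setDUl setDv setU0; apply/setDidPl.
rewrite -[RHS](@card_in_imset _ _ (fun T => T :|: A)); last first.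
  move=> S T; rewrite [_ \in _]inE [T \in _]inE.
  move=> /andP[_ /disjA dS] /andP[_ /disjA dT] eqST.
  by rewrite -(decomp S dS) eqST decomp.
apply: eq_card => T; rewrite inE; apply/andP/imsetP.
- move=> [TC sAT]; have [cT adjT] := elimT (clique_copiesP _ _) TC.
  exists (T :\: A); last by rewrite -{1}(setID T A) (setIidPr sAT) setUC.
  rewrite inE; apply/andP; split.
    by have := clique_sub TC (subsetDl T A); rewrite cardsDS // cT cA addnK.
  rewrite disjoint_subset; apply/subsetP => v; rewrite !inE => /andP[vA vT].
  apply/exists_inPn => x xA; rewrite negbK; apply: adjT => //; first exact: (subsetP sAT).
  by apply: contraNneq vA => <-.
- case=> S; rewrite inE => /andP[/clique_copiesP[cS adjS] dS] ->.
  split; last exact: subsetUr.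
  apply/clique_copiesP; split.
    by rewrite cardsU (eqP (_ : S :&: A == set0)) ?setI_eq0 ?disjA //
      cards0 subn0 cS cA.
  move=> x y; rewrite !inE => /orP[xS|xA] /orP[yS|yA] neq_xy.
  + exact: adjS.
  + by rewrite adj_sym (joined S).
  + exact: (joined S).
  + exact: adjA.
Qed.

(** * Double counting and Bonferroni inequalities *)

(** Counts the pairs [z], [S] with [f z \subset S] in both orders. Singletons, pairs with one fixed
    vertex, and the identity serve as [f]. *)
Lemma sum_card_exchange (I T : finType) (C : {set {set T}}) (Z : {set I})
    (f : I -> {set T}) :
  (\sum_(z in Z) #|[set S in C | f z \subset S]| =
   \sum_(S in C) #|[set z in Z | f z \subset S]|)%N.
Proof.
under eq_bigr do rewrite -sum1_card.
under [RHS]eq_bigr do rewrite -sum1_card.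
rewrite (exchange_big_dep (mem C)) /=; last by move=> z S _; rewrite inE => /andP[].
apply: eq_bigr => S SC; apply: eq_bigl => z; rewrite !inE SC.
by rewrite andbC.
Qed.

Lemma sum_cliques_over (G : sgraph) (j : nat) (Z : {set G}) :
  (\sum_(z in Z) #|cliques_over j [set z]| =
   \sum_(S in clique_copies G j) #|S :&: Z|)%N.
Proof.
rewrite sum_card_exchange; apply: eq_bigr => S _.
by apply: eq_card => z; rewrite !inE sub1set andbC.
Qed.

Lemma sum_cliques_over_setT (G : sgraph) (j : nat) :
  (\sum_z #|@cliques_over G j [set z]| = j * #|clique_copies G j|)%N.
Proof.
have := sum_cliques_over j [set: G].
rewrite (eq_bigl predT) => [->|z]; last by rewrite inE.
rewrite mulnC -sum_nat_const.
by apply: eq_bigr => S /card_clique <-; rewrite setIT.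
Qed.

Lemma card_disjoint_cliques (G : sgraph) (j : nat) (Z : {set G}) :
  #|[set S in clique_copies G j | [disjoint S & Z]]| =
  (\sum_(S in clique_copies G j) (#|S :&: Z| == 0))%N.
Proof.
rewrite -sum1_card big_mkcond [RHS]big_mkcond /=; apply: eq_bigr => S _.
by rewrite inE -setI_eq0 -cards_eq0; case: (S \in _) => //=; case: eqP.
Qed.

(** With [s = #|S :&: Z|], each clique satisfies [1 <= (s == 0) + s]. *)
Lemma union_bound (G : sgraph) (j : nat) (Z : {set G}) :
  (#|clique_copies G j| <=
   #|[set S in clique_copies G j | [disjoint S & Z]]| +
   \sum_(z in Z) #|cliques_over j [set z]|)%N.
Proof.
rewrite card_disjoint_cliques sum_cliques_over -big_split -sum1_card /=.
by apply: leq_sum => S _; case: #|_|.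
Qed.

(** With [s = #|S :&: Z|], each clique satisfies [(s == 0) + s <= 1 + s * (s - 1)]. The pairs are
    ordered, so the last term is twice the usual Bonferroni term. *)
Lemma bonferroni (G : sgraph) (j : nat) (Z : {set G}) :
  (#|[set S in clique_copies G j | [disjoint S & Z]]| +
   \sum_(z in Z) #|cliques_over j [set z]| <=
   #|clique_copies G j| +
   \sum_(z in Z) \sum_(z' in Z | z' != z) #|cliques_over j [set z; z']|)%N.
Proof.
have -> : (\sum_(z in Z) \sum_(z' in Z | z' != z) #|cliques_over j [set z; z']|
   = \sum_(S in clique_copies G j) #|S :&: Z| * (#|S :&: Z|).-1)%N.
  have E z : (\sum_(z' in Z | z' != z) #|cliques_over j [set z; z']| =
      \sum_(S in clique_copies G j)
        #|[set z' in Z :\ z | [set z; z'] \subset S]|)%N.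
    rewrite -(sum_card_exchange _ _ (fun z' => [set z; z'])).
    by apply: eq_bigl => z'; rewrite !inE andbC.
  under eq_bigr do rewrite E.
  rewrite exchange_big /=; apply: eq_bigr => S _.
  rewrite -sum_nat_const big_mkcond [RHS]big_mkcond /=; apply: eq_bigr => z _.
  rewrite inE andbC; case zZ: (z \in Z) => //=; case: ifP => zS.
    rewrite (cardsD1 z (S :&: Z)) inE zS zZ /=.
    apply: eq_card => x; rewrite !inE subUset !sub1set zS /=.
    by case: (x == z); case: (x \in Z); case: (x \in S).
  apply: eq_card0 => x.
  by rewrite !inE subUset sub1set zS andbF.
rewrite card_disjoint_cliques sum_cliques_over -big_split -sum1_card -big_split /=.
apply: leq_sum => S _; case: #|_| => [|[|s]] //=; nia.
Qed.

(** * Cliques between nested sets *)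

Lemma card_between (T : finType) (A Q : {set T}) (r : nat) :
  A \subset Q -> (#|A| <= r)%N ->
  #|[set K : {set T} | (#|K| == r) && (A \subset K) && (K \subset Q)]| =
  'C(#|Q| - #|A|, r - #|A|).
Proof.
move=> sAQ leAr; rewrite -cardsDS // -cards_draws.
rewrite -(@card_in_imset _ _ (fun K => K :\: A)).
- apply: eq_card => B; rewrite !inE; apply/imsetP/andP.
  + case=> K; rewrite inE => /andP[/andP[/eqP cK sAK] sKQ] ->.
    by rewrite setSD // cardsDS // cK.
  + case; rewrite subsetD => /andP[sBQ dBA] /eqP cB; exists (B :|: A).
      rewrite inE subsetUr subUset sBQ sAQ !andbT cardsU.
      by rewrite (eqP (_ : B :&: A == set0)) ?setI_eq0 // cards0 cB subn0 subnK.
    by rewrite setDUl setDv setU0; symmetry; apply/setDidPl.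
- move=> S K; rewrite !inE.
  move=> /andP[/andP[_ sAS] _] /andP[/andP[_ sAK] _] eqSK.
  by rewrite -(setID S A) -(setID K A) eqSK (setIidPr sAS) (setIidPr sAK).
Qed.

Lemma card_cliques_between (G : sgraph) (A Q : {set G}) (r m : nat) :
  Q \in clique_copies G m -> A \subset Q -> (#|A| <= r)%N ->
  #|[set K in cliques_over r A | K \subset Q]| = 'C(m - #|A|, r - #|A|).
Proof.
move=> QC sAQ leAr; rewrite -(card_clique QC) -card_between //.
apply: eq_card => K; rewrite !inE; case sKQ: (K \subset Q); rewrite ?andbF // !andbT.
congr andb; case cK: (#|K| == r) => //=.
by have := clique_sub QC sKQ; rewrite (eqP cK) inE cK.
Qed.

(** Counts pairs [K \subset Q]: every [r]-set between [A] and an [m]-clique [Q] is itself a clique,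
    so each [Q] over [A] is met the same binomial number of times. *)
Lemma sum_cliques_over_cliques (G : sgraph) (A : {set G}) (r m : nat) :
  (#|A| <= r)%N ->
  (\sum_(K in cliques_over r A) #|cliques_over m K| =
   'C(m - #|A|, r - #|A|) * #|cliques_over m A|)%N.
Proof.
move=> leAr; rewrite (sum_card_exchange _ _ id) mulnC -sum_nat_const.
rewrite [LHS](bigID (fun Q : {set G} => A \subset Q)) /= [X in (_ + X)%N]big1 ?addn0.
  rewrite [RHS](eq_bigl (fun Q : {set G} => (Q \in clique_copies G m) && (A \subset Q))).
    apply: eq_bigr => Q /andP[QC sAQ].
    exact: card_cliques_between.
  by move=> Q; rewrite inE.
move=> Q /andP[_ nAQ]; apply: eq_card0 => K; rewrite !inE.
by apply: contraNF nAQ => /andP[/andP[_ sAK] sKQ]; apply: subset_trans sKQ.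
Qed.

(** * Clique counts when every vertex has few non-neighbours *)

Lemma in_nonneighbours1 (G : sgraph) (u v : G) :
  (v \in nonneighbours [set u]) = ~~ adj u v.
Proof.
rewrite inE; apply/exists_inP/idP => [[x /set1P->] //|h].
by exists u; rewrite ?inE.
Qed.

Lemma set1_clique (G : sgraph) (v : G) : [set v] \in clique_copies G 1.
Proof.
apply/clique_copiesP; split; first exact: cards1.
by move=> x y /set1P-> /set1P->; rewrite eqxx.
Qed.

Lemma card_cliques_over1_le (G : sgraph) (j : nat) (v : G) :
  (#|@cliques_over G j.+1 [set v]| <= #|clique_copies G j|)%N.
Proof. by rewrite -addn1 card_cliques_over_le // cards1. Qed.

Lemma card_nonneighbours_le (G : sgraph) (D : nat) (A : {set G}) :
  (forall v : G, #|nonneighbours [set v]| <= D)%N ->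
  (#|nonneighbours A| <= #|A| * D)%N.
Proof.
move=> hD; have -> : nonneighbours A = \bigcup_(x in A) nonneighbours [set x].
  apply/setP => v; rewrite inE; apply/exists_inP/bigcupP => -[x xA].
    by move=> h; exists x => //; rewrite inE; apply/exists_inP; exists x; rewrite ?inE.
  by rewrite inE => /exists_inP[y /set1P-> h]; exists x.
apply: leq_trans (_ : \sum_(x in A) #|nonneighbours [set x]| <= _)%N.
  elim/big_rec2: _ => [|x m B _ ih]; first by rewrite cards0.
  by apply: leq_trans (leq_card_setU _ _) _; rewrite leq_add2l.
by rewrite -sum_nat_const; apply: leq_sum.
Qed.

Lemma card_cliquesS_le (G : sgraph) (j : nat) :
  (j.+1 * #|clique_copies G j.+1| <= #|G| * #|clique_copies G j|)%N.
Proof.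
rewrite -sum_cliques_over_setT -[#|G|]cardsT -sum_nat_const.
rewrite [leqRHS](eq_bigl predT) => [|v]; last by rewrite inE.
by apply: leq_sum => v _; apply: card_cliques_over1_le.
Qed.

(** The union bound at a vertex [z] loses the [j]-cliques through its non-neighbours. Summed over
    [z], each vertex is charged at most [D] times, so the loss is a multiple of c_j itself and the
    inequality controls c_{j+1}/c_j. *)
Lemma card_cliquesS_ge (G : sgraph) (D j : nat) :
  (forall v : G, #|nonneighbours [set v]| <= D)%N ->
  (#|G| * #|clique_copies G j| <=
   j.+1 * #|clique_copies G j.+1| + D * (j * #|clique_copies G j|))%N.
Proof.
move=> hD.
have E : (\sum_(z : G) \sum_(v in nonneighbours [set z]) #|cliques_over j [set v]| =
    \sum_(v : G) #|nonneighbours [set v]| * #|cliques_over j [set v]|)%N.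
  rewrite (exchange_big_dep predT) //=; apply: eq_bigr => v _.
  rewrite -sum_nat_const; apply: eq_bigl => z.
  by rewrite !in_nonneighbours1 adj_sym.
apply: leq_trans (_ : \sum_(z : G) (#|@cliques_over G j.+1 [set z]| +
  \sum_(v in nonneighbours [set z]) #|cliques_over j [set v]|) <= _)%N.
  rewrite -sum_nat_const; apply: leq_sum => v _.
  by rewrite -addn1 (card_cliques_over _ (set1_clique v)) union_bound.
rewrite big_split /= E sum_cliques_over_setT leq_add2l.
rewrite -(sum_cliques_over_setT G j) big_distrr /=.
by apply: leq_sum => v _; rewrite leq_mul2r hD orbT.
Qed.

Lemma card_cliques_over_ge (G : sgraph) (j a : nat) (A : {set G}) :
  A \in clique_copies G a ->
  (#|clique_copies G j.+1| <= #|cliques_over (j.+1 + a) A| +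
   #|nonneighbours A| * #|clique_copies G j|)%N.
Proof.
move=> hA; rewrite (card_cliques_over _ hA).
apply: leq_trans (union_bound _ (nonneighbours A)) _.
rewrite leq_add2l -sum_nat_const; apply: leq_sum => v _.
exact: card_cliques_over1_le.
Qed.

(** In [bonferroni] with [Z = nonneighbours A], the linear term is replaced by |Z| c_{j+1} at the
    cost |Z| D c_j ([h1]), and the pair term is at most |Z|^2 c_j ([h2]). *)
Lemma card_cliques_over_bonferroni (G : sgraph) (D j a : nat) (A : {set G}) :
  (forall v : G, #|nonneighbours [set v]| <= D)%N ->
  A \in clique_copies G a ->
  (#|cliques_over (j.+2 + a) A| +
     #|nonneighbours A| * #|clique_copies G j.+1| <=
   #|clique_copies G j.+2| +
     (#|nonneighbours A| * D + #|nonneighbours A| * #|nonneighbours A|) *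
       #|clique_copies G j|)%N.
Proof.
move=> hD hA; set z := #|nonneighbours A|; rewrite (card_cliques_over _ hA) mulnDl addnA.
have h1 : (z * #|clique_copies G j.+1| <=
  \sum_(v in nonneighbours A) #|cliques_over j.+2 [set v]|
    + z * D * #|clique_copies G j|)%N.
  rewrite -mulnA -!sum_nat_const -big_split /=; apply: leq_sum => v _.
  rewrite -[j.+2]addn1; apply: leq_trans (card_cliques_over_ge _ (set1_clique v)) _.
  by rewrite leq_add2l leq_mul2r hD orbT.
have h2 : (\sum_(v in nonneighbours A) \sum_(v' in nonneighbours A | v' != v)
    #|cliques_over j.+2 [set v; v']| <= z * z * #|clique_copies G j|)%N.
  rewrite -mulnA -!sum_nat_const; apply: leq_sum => v _.
  rewrite big_mkcondr /=; apply: leq_sum => v' _; case: eqP => //= neq_v.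
  rewrite -addn2 card_cliques_over_le // cards2.
  by case: eqP neq_v => // ->.
have := bonferroni j.+2 (nonneighbours A); lia.
Qed.

Lemma card_cliques_over_clique_le (G : sgraph) (r m : nat) (K : {set G}) :
  K \in clique_copies G r -> (#|cliques_over (m + r) K| <= #|clique_copies G m|)%N.
Proof. by move/card_clique; apply: card_cliques_over_le. Qed.

Lemma cliques_over0 (G : sgraph) (j : nat) :
  @cliques_over G j set0 = clique_copies G j.
Proof. by apply/setP => K; rewrite inE sub0set andbT. Qed.

(** Double counts the [i]-cliques inside [(j.+1 + i)]-cliques, each [i]-clique having at most
    [i * D] non-neighbours. It serves to show that c_{2j} times the central binomial is nearly
    c_j^2. *)
Lemma card_cliquesD_ge (G : sgraph) (D i j : nat) :
  (forall v : G, #|nonneighbours [set v]| <= D)%N ->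
  (#|clique_copies G i| * #|clique_copies G j.+1| <=
   'C(j.+1 + i, i) * #|clique_copies G (j.+1 + i)| +
   #|clique_copies G i| * (i * D * #|clique_copies G j|))%N.
Proof.
move=> hD; have := @sum_cliques_over_cliques G set0 i (j.+1 + i).
rewrite cards0 => /(_ isT); rewrite !cliques_over0 !subn0 => <-.
rewrite -!sum_nat_const -big_split /=; apply: leq_sum => K KC.
apply: leq_trans (card_cliques_over_ge _ KC) _.
rewrite leq_add2l leq_mul2r -{1}(card_clique KC).
by rewrite card_nonneighbours_le ?orbT.
Qed.

(** * Gadgets and the correction built from them *)

(* For a fixed edge e of an (r+2)-set Q, the unique function of the r-subsets K of
   Q, depending only on #|e :&: K|, whose sum over the K containing an edge f of
   Q is 1 for f = e and 0 otherwise. *)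
Definition gadget (R : realType) (T : finType) (r : nat) (e K : {set T}) : R :=
  (e \subset K)%:R - (r%:R - 2) / (r%:R - 1) * #|e :&: K|%:R + (r%:R - 2) / r%:R.

Lemma bin2_real (R : realType) (m : nat) :
  'C(m.+2, m)%:R = (m%:R + 2) * (m%:R + 1) / 2 :> R.
Proof.
have /(congr1 (fun k => k%:R : R)) : ('C(m.+2, m) * 2 = m.+2 * m.+1)%N.
  rewrite -(bin_sub (leqW (leqnSn m))) (_ : (m.+2 - m = 2)%N); last lia.
  by rewrite (bin_ffact m.+2 2) ffactnS ffactn1.
rewrite !natrM -(addn2 m) -(addn1 m) !natrD => h; lra.
Qed.

(** The three terms of the gadget sum to counts of [r]-sets between [f], [f :|: [set v]] or
    [f :|: e] and [Q]. These depend only on [#|e :&: f|], which leaves three rational identities in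
    [r]. *)
Lemma gadget_sum (R : realType) (G : sgraph) (r : nat) (e f Q : {set G}) :
  (4 <= r)%N -> Q \in clique_copies G (r + 2) ->
  #|e| = 2%N -> e \subset Q -> #|f| = 2%N -> f \subset Q ->
  \sum_(K in cliques_over r f | K \subset Q) gadget R r e K = (e == f)%:R.
Proof.
move=> hr hQ ce sQe cf sQf.
have cU (A : {set G}) : A \subset Q -> (#|f :|: A| <= 4)%N ->
    #|[set K in cliques_over r (f :|: A) | K \subset Q]| =
    'C((r - #|f :|: A|).+2, r - #|f :|: A|).
  move=> sAQ le4; rewrite (card_cliques_between hQ) ?subUset ?sQf ?(leq_trans le4) //.
  by congr 'C(_, _); lia.
have S0 : \sum_(K in cliques_over r f | K \subset Q) (1 : R) = 'C(r, r - 2)%:R.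
  under eq_bigr do rewrite -[1]mulr1n.
  rewrite -natr_sum sum1_card; congr _%:R.
  have := cU set0 (sub0set _); rewrite setU0 cf => /(_ isT).
  rewrite (_ : (r - 2).+2 = r); last lia.
  by move=> <-; apply: eq_card => K; rewrite [RHS]inE.
have S1 : \sum_(K in cliques_over r f | K \subset Q) (#|e :&: K|%:R : R) =
    (\sum_(v in e) 'C((r - #|f :|: [set v]|).+2, r - #|f :|: [set v]|))%:R.
  rewrite -natr_sum; congr _%:R.
  have sv v : v \in e -> [set v] \subset Q by rewrite sub1set; apply: subsetP.
  have le4 (v : G) : (#|f :|: [set v]| <= 4)%N.
    by rewrite (leq_trans (leq_card_setU _ _)) // cf cards1.
  under [RHS]eq_bigr => v ve do rewrite -(cU _ (sv v ve) (le4 v)).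
  transitivity (\sum_(v in e)
     #|[set K in [set K in cliques_over r f | K \subset Q] | [set v] \subset K]|)%N.
    rewrite sum_card_exchange; apply: eq_big => [K|K _]; first by rewrite [RHS]inE.
    by apply: eq_card => v; rewrite !inE sub1set.
  apply: eq_bigr => v _; apply: eq_card => K; rewrite !inE subUset -!andbA.
  by congr andb; congr andb; congr andb; rewrite andbC.
have S2 : \sum_(K in cliques_over r f | K \subset Q) ((e \subset K)%:R : R) =
    'C((r - #|f :|: e|).+2, r - #|f :|: e|)%:R.
  rewrite -natr_sum -cU // ?(leq_trans (leq_card_setU _ _)) ?cf ?ce //.
  rewrite -sum1_card -big_mkcondr /=; congr _%:R; apply: eq_bigl => K.
  rewrite !inE subUset -!andbA.
  by congr andb; congr andb; congr andb; rewrite andbC.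
rewrite /gadget.
under eq_bigr => K _ do rewrite -[_ / r%:R]mulr1.
rewrite big_split sumrB /= -!mulr_sumr S0 S1 S2 => {S0 S1 S2 cU}.
(* As [#|f :|: e| <= 4], writing [r] as [s + 4] makes every truncated subtraction exact. *)
have [s ->] : exists s, r = s.+4 by exists (r - 4)%N; lia.
(* Adding [v] to [f] leaves size 2 when [v] is in [f] and gives size 3 otherwise. *)
have -> : (\sum_(v in e) 'C((s.+4 - #|f :|: [set v]|).+2, s.+4 - #|f :|: [set v]|) =
   #|e :&: f| * 'C(s.+4, s.+2) + (2 - #|e :&: f|) * 'C(s.+3, s.+1))%N.
  rewrite -[X in (X - _)%N]ce -cardsD (bigID (mem f)) /=.
  congr addn; rewrite -sum_nat_const.
    apply: eq_big => [v|v /andP[_ vf]]; first by rewrite [RHS]inE.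
    by rewrite (setUidPl _) ?sub1set // cf.
  apply: eq_big => [v|v /andP[_ vf]]; first by rewrite !inE andbC.
  by rewrite setUC cardsU1 vf cf.
have := cardsUI f e; rewrite cf ce setIC.
have : (#|e :&: f| <= 2)%N by rewrite -ce subset_leq_card ?subsetIl.
have -> : (e == f) = (#|e :&: f| == 2%N).
  apply/eqP/eqP => [<-|h]; first by rewrite setIid.
  have /eqP ef : e :&: f == e by rewrite eqEcard subsetIl h ce.
  by apply/eqP; rewrite eqEcard -{1}ef subsetIr ce cf.
move: #|e :&: f| #|f :|: e| => i u.
have es : s.+4%:R = s%:R + 4 :> R by rewrite -(addn4 s) natrD.
have b4 : 'C(s.+4, s.+2)%:R = (s%:R + 4) * (s%:R + 3) / 2 :> R.
  by rewrite bin2_real -(addn2 s) natrD; congr (_ * _ / _); lra.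
have b3 : 'C(s.+3, s.+1)%:R = (s%:R + 3) * (s%:R + 2) / 2 :> R.
  by rewrite bin2_real -(addn1 s) natrD; congr (_ * _ / _); lra.
have s0 : 0 <= s%:R :> R by apply: ler0n.
have -> : (s.+4 - 2 = s.+2)%N by lia.
rewrite natrD !natrM es b4 b3 => i2 hu.
case: i i2 hu => [|[|[|//]]] _ hu.
- have -> : (s.+4 - u = s)%N by lia.
  have -> : (0%N == 2%N)%:R = 0 :> R by [].
  rewrite bin2_real subn0 mul0r add0r; move: (s%:R : R) s0 => x x0.
  by clear - x0; field; lra.
- have -> : (s.+4 - u = s.+1)%N by lia.
  have -> : (1%N == 2%N)%:R = 0 :> R by [].
  rewrite b3 (_ : (2 - 1 = 1)%N) //; move: (s%:R : R) s0 => x x0.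
  by clear - x0; field; lra.
- have -> : (s.+4 - u = s.+2)%N by lia.
  have -> : (2%N == 2%N)%:R = 1 :> R by [].
  rewrite b4 subnn mul0r addr0; move: (s%:R : R) s0 => x x0.
  by clear - x0; field; lra.
Qed.

(** [K] misses only the two vertices of [P]. For an edge with 0, 1 or 2 ends in [P] the absolute
    value of the gadget is 2/(r(r-1)), (r-2)/(r(r-1)) or (r-2)/r, and there are of order r^2, r and
    1 such edges. *)
Lemma gadget_bound (R : realType) (G : sgraph) (r : nat) (K Q : {set G}) :
  (4 <= r)%N -> #|K| = r -> K \subset Q -> Q \in clique_copies G (r + 2) ->
  \sum_(e in clique_copies G 2 | e \subset Q) `|gadget R r e K| <= 6.
Proof.
move=> hr cK sKQ hQ; pose P := Q :\: K.
have cP : #|P| = 2%N by rewrite cardsDS // (card_clique hQ) cK addKn.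
have [x xE] : {x : R | r%:R = x} by exists r%:R.
have x4 : 4 <= x by rewrite -xE (ler_nat _ 4).
have cE (A : {set G}) : A \subset Q -> (#|A| <= 2)%N ->
    \sum_(e in clique_copies G 2 | e \subset Q) (A \subset e)%:R =
    'C(r + 2 - #|A|, 2 - #|A|)%:R :> R.
  move=> sAQ leA; rewrite -(card_cliques_between hQ sAQ leA) -sum1_card.
  rewrite -natr_sum; congr _%:R; rewrite -[LHS]big_mkcondr.
  apply: eq_bigl => e; rewrite [RHS]inE [X in _ = X && _]inE.
  by rewrite -!andbA; congr andb; rewrite andbC.
(* Each of the three cases is dominated by one summand of this majorant. All summands are written as
   indicators [A \subset e], so that [cE] evaluates them; the totals are at most 5/2, 5/2 and 1, the
   first two being attained at r = 4. *)
apply: (@le_trans _ _ (\sum_(e in clique_copies G 2 | e \subset Q)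
   (2 / (x * (x - 1)) * (set0 \subset e)%:R +
    x^-1 * (\sum_(v in P) ([set v] \subset e)%:R) + (P \subset e)%:R))).
  apply: ler_sum => e /andP[/card_clique ce sQe].
  have -> : \sum_(v in P) ([set v] \subset e)%:R = #|e :&: P|%:R :> R.
    rewrite -natr_sum; congr _%:R; rewrite -sum1_card -[LHS]big_mkcondr.
    by apply: eq_bigl => v; rewrite [RHS]inE sub1set andbC.
  rewrite sub0set mulr1 /gadget xE.
  have hKP : (#|e :&: K| + #|e :&: P| = 2)%N.
    by rewrite -ce -(cardsID K e) /P setDE setIA (setIidPl sQe) -setDE.
  have -> : (e \subset K) = (#|e :&: P| == 0%N).
    rewrite cards_eq0 /P setDE setIA (setIidPl sQe) -setDE.
    by rewrite setD_eq0.
  have hPe : (2 <= #|e :&: P|)%N -> P \subset e.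
    move=> h; apply/setIidPr/eqP.
    by rewrite eqEcard subsetIr cP.
  move: hPe hKP; move: #|e :&: P| #|e :&: K| => [|[|[|p]]] k hPe hk; last lia.
  - have -> : k = 2%N by lia.
    have -> : 1%:R - (x - 2) / (x - 1) * 2%:R + (x - 2) / x =
        2 / (x * (x - 1)).
      by clear - x4; field; lra.
    rewrite ger0_norm; last by rewrite divr_ge0 ?mulr_ge0 //; clear - x4; lra.
    by rewrite mulr0 addr0 lerDl ler0n.
  - have -> : k = 1%N by lia.
    have -> : 0%:R - (x - 2) / (x - 1) * 1%:R + (x - 2) / x =
        - ((x - 2) / (x - 1) * x^-1).
      by clear - x4; field; lra.
    rewrite normrN ger0_norm; last first.
      by rewrite mulr_ge0 ?divr_ge0 ?invr_ge0 //; clear - x4; lra.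
    rewrite mulr1 -[leLHS]add0r -[leLHS]addr0 !lerD ?ler0n //.
      by rewrite divr_ge0 ?mulr_ge0 //; clear - x4; lra.
    rewrite ler_piMl ?invr_ge0 ?ler_pdivrMr //; clear - x4; lra.
  - have -> : k = 0%N by lia.
    rewrite hPe // (_ : true%:R = 1 :> R) // mulr0 subr0 add0r ger0_norm; last first.
      by rewrite divr_ge0 //; clear - x4; lra.
    rewrite -[leLHS]add0r lerD ?addr_ge0 ?divr_ge0 ?mulr_ge0 ?invr_ge0 //;
      rewrite ?ler_pdivrMr //; clear - x4; lra.
rewrite !big_split /= -!mulr_sumr exchange_big /= cE ?sub0set ?cards0 //.
rewrite cE ?subsetDl ?cP //.
under eq_bigr => v vP do rewrite cE ?cards1 ?sub1set ?(subsetP (subsetDl Q K)) //.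
rewrite sumr_const cP !subn0 subnn bin0 subn1 addn2 bin1 /=.
rewrite (_ : 'C(r.+2, 2) = 'C(r.+2, r)); last first.
  by rewrite -(bin_sub (leqW (leqnSn r))); congr 'C(_, _); lia.
have xS : r.+1%:R = x + 1 by rewrite -xE natr1.
rewrite bin2_real xE xS -mulr_natr; clear - x4.
have h1 : 2 / (x * (x - 1)) * ((x + 2) * (x + 1) / 2) <= 5 / 2.
  have : 0 <= (x - 4) * (3 * x + 1) by rewrite mulr_ge0; lra.
  have x0 : 0 < x * (x - 1) by rewrite mulr_gt0 //; lra.
  by move=> q; rewrite mulrAC ler_pdivrMr //; nra.
have h2 : x^-1 * ((x + 1) * 2) <= 5 / 2.
  rewrite mulrC ler_pdivrMr; lra.
lra.
Qed.

Definition correction (R : realType) (G : sgraph) (r : nat)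
    (y : {set G} -> R) (K : {set G}) : R :=
  \sum_(Q in cliques_over (r + 2) K)
    \sum_(e in clique_copies G 2 | e \subset Q) y e * gadget R r e K.

(** After exchanging sums, only cliques [Q] over [f] remain. In each of them the gadgets of all
    edges other than [f] cancel at [f], leaving [y f]. *)
Lemma correction_sum (R : realType) (G : sgraph) (r : nat)
    (y : {set G} -> R) (f : {set G}) :
  (4 <= r)%N -> f \in clique_copies G 2 ->
  \sum_(K in cliques_over r f) correction r y K =
  y f * #|cliques_over (r + 2) f|%:R.
Proof.
move=> hr hf; have cf := card_clique hf.
rewrite /correction (exchange_big_dep (mem (cliques_over (r + 2) f))) /=; last first.
  move=> K Q; rewrite inE => /andP[_ sfK]; rewrite inE => /andP[hQ sKQ].
  by rewrite inE hQ (subset_trans sfK).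
rewrite mulr_natr -sumr_const; apply: eq_bigr => Q; rewrite inE => /andP[hQ sfQ].
rewrite (eq_bigl (fun K => (K \in cliques_over r f) && (K \subset Q))); last first.
  by move=> K; rewrite [X in _ && X]inE hQ.
rewrite exchange_big /= (bigD1 f) ?hf //= -mulr_sumr.
rewrite gadget_sum // eqxx mulr1 big1 ?addr0 // => e /andP[/andP[he seQ] nef].
by rewrite -mulr_sumr gadget_sum ?(card_clique he) // (negPf nef) mulr0.
Qed.

(** Each [Q] over [K] adds at most [6 * b] by [gadget_bound], and there are no more such [Q] than
    edges because [Q :\: K] is an edge. *)
Lemma correction_bound (R : realType) (G : sgraph) (r : nat)
    (y : {set G} -> R) (b : R) (K : {set G}) :
  (4 <= r)%N -> K \in clique_copies G r ->
  (forall e, e \in clique_copies G 2 -> `|y e| <= b) -> 0 <= b ->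
  `|correction r y K| <= b * 6 * #|clique_copies G 2|%:R.
Proof.
move=> hr hK hy b0; have cK := card_clique hK.
apply: (@le_trans _ _ (b * 6 * #|cliques_over (2 + r) K|%:R)); last first.
  by rewrite ler_wpM2l ?mulr_ge0 // ler_nat card_cliques_over_le.
rewrite addnC mulr_natr -sumr_const; apply: le_trans (ler_norm_sum _ _ _) _.
apply: ler_sum => Q; rewrite inE => /andP[hQ sKQ].
apply: le_trans (ler_norm_sum _ _ _) _.
apply: (@le_trans _ _ (b * \sum_(e in clique_copies G 2 | e \subset Q) `|gadget R r e K|)).
  rewrite mulr_sumr; apply: ler_sum => e /andP[he _].
  by rewrite normrM ler_wpM2r // hy.
by rewrite ler_wpM2l // gadget_bound.
Qed.

(** * Ratios of consecutive clique counts and densities at an edge *)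

(** The factor [#|G|] brings the ratio close to [j]; the linear Bonferroni term |Z| c_{j-1}/c_j
    becomes (|Z|/n) times this number. *)
Definition clique_ratio (R : realType) (G : sgraph) (j : nat) : R :=
  #|G|%:R * #|clique_copies G j.-1|%:R / #|clique_copies G j|%:R.

Lemma clique_ratio_bounds (R : realType) (G : sgraph) (D j m : nat) (d : R) :
  (forall v : G, #|nonneighbours [set v]| <= D)%N ->
  (0 < #|G|)%N -> 0 <= d -> D%:R <= d * #|G|%:R -> m%:R * d <= 1 / 2 ->
  (0 < j <= m)%N ->
  [/\ 0 < #|clique_copies G j|%:R :> R,
      j%:R <= clique_ratio R G j
    & clique_ratio R G j <= j%:R * (1 + 2 * j%:R * d)].
Proof.
move=> hD; rewrite -(ltr0n R); set n := #|G|%:R => n0 d0 hDd hmd.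
have step i : (i <= m)%N -> 0 < #|clique_copies G i|%:R :> R ->
    n * #|clique_copies G i|%:R * (1 - i%:R * d) <=
      i.+1%:R * #|clique_copies G i.+1|%:R.
  move=> im; move: (card_cliquesS_ge i hD).
  rewrite -(ler_nat R) natrD !natrM -/n.
  move: #|clique_copies G i|%:R #|clique_copies G i.+1|%:R => a b h a0.
  have : D%:R * (i%:R * a) <= d * n * (i%:R * a) by rewrite ler_wpM2r // mulr_ge0 // ltW.
  by move: h; clear; lra.
have idm i : (i <= m)%N -> i%:R * d <= 1 / 2.
  by move=> im; apply: le_trans hmd; rewrite ler_wpM2r // ler_nat.
have pos i : (i <= m)%N -> 0 < #|clique_copies G i|%:R :> R.
  elim: i => [_|i ih im].
    rewrite ltr0n (cardD1 set0) (_ : set0 \in _) //.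
    by apply/clique_copiesP; split => [|x y]; rewrite ?cards0 ?inE.
  have ci := ih (ltnW im).
  have : 0 < i.+1%:R * #|clique_copies G i.+1|%:R :> R.
    apply: lt_le_trans (step i (ltnW im) ci); rewrite !mulr_gt0 //.
    by move: (idm _ (ltnW im)); clear; lra.
  by rewrite pmulr_rgt0.
case: j => [//|i] /= im; split; first exact: pos.
- rewrite /clique_ratio ler_pdivlMr ?pos //= -/n.
  by rewrite -!natrM ler_nat card_cliquesS_le.
- rewrite /clique_ratio ler_pdivrMr ?pos //= -/n.
  have := step i (ltnW im) (pos i (ltnW im)); have := idm _ (ltnW im).
  have A0 : 0 <= n * #|clique_copies G i|%:R by rewrite mulr_ge0 // ltW.
  have := pos _ im; move: (n * #|clique_copies G i|%:R) A0.
  move: (#|clique_copies G i.+1|%:R : R).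
  have -> : i.+1%:R = i%:R + 1 :> R by rewrite natr1.
  move: (i%:R : R) (ler0n R i) => x x0 b A A0 b0 xd h.
  have xd0 : 0 <= x * d by rewrite mulr_ge0.
  clear - A0 b0 x0 d0 xd xd0 h.
  (* The factor 1 - xd is inverted through (1 - q)(1 + 2q) >= 1 for 0 <= q <= 1/2. *)
  have h1 : A <= A * (1 - x * d) * (1 + 2 * (x * d)).
    have : 0 <= A * (x * d) * (1 - 2 * (x * d)) by rewrite !mulr_ge0 //; lra.
    lra.
  have h2 : A * (1 - x * d) * (1 + 2 * (x * d)) <= (x + 1) * b * (1 + 2 * (x * d)).
    by rewrite ler_wpM2r //; lra.
  have : 0 <= (x + 1) * b * d by rewrite !mulr_ge0 //; lra.
  lra.
Qed.

(** The union bound and Bonferroni, divided by c_j. As |Z| <= 2D, the quadratic term |Z|D + |Z|^2 is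
    at most 6(dn)^2, and n^2 c_{j-2}/c_j is the product of two consecutive ratios. *)
Lemma local_density (R : realType) (G : sgraph) (D j m : nat) (d : R) (e : {set G}) :
  (forall v : G, #|nonneighbours [set v]| <= D)%N ->
  (0 < #|G|)%N -> 0 <= d -> D%:R <= d * #|G|%:R -> m%:R * d <= 1 / 2 ->
  (1 < j <= m)%N -> e \in clique_copies G 2 ->
  let P : R := #|cliques_over (j + 2) e|%:R / #|clique_copies G j|%:R in
  let z : R := #|nonneighbours e|%:R / #|G|%:R in
  [/\ z <= 2 * d, 1 - z * clique_ratio R G j <= P &
      P <= 1 - z * clique_ratio R G j
         + 6 * d ^+ 2 * (clique_ratio R G j * clique_ratio R G j.-1)].
Proof.
move=> hD n0 d0 hDd hmd /andP[j2 jm] he P z.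
have [pj _ _] := @clique_ratio_bounds R G D j m d hD n0 d0 hDd hmd
  (introT andP (conj (ltnW j2) jm)).
have hj1 : (0 < j.-1 <= m)%N by lia.
have [pj1 _ _] := @clique_ratio_bounds R G D j.-1 m d hD n0 d0 hDd hmd hj1.
have hz : #|nonneighbours e|%:R <= 2 * D%:R :> R.
  by rewrite -natrM ler_nat -(card_clique he) card_nonneighbours_le.
have := @card_cliques_over_ge G j.-1 2 e he.
have := @card_cliques_over_bonferroni G D j.-2 2 e hD he.
case: j j2 jm hj1 pj pj1 @P => [|[|j]] //= _ _ _ pj pj1.
rewrite -!(ler_nat R) !natrD !natrM natrD !natrM /z /clique_ratio /=.
have {}n0 : 0 < #|G|%:R :> R by rewrite ltr0n.
move: pj pj1 n0 hDd hz (ler0n R #|nonneighbours e|) (ler0n R #|clique_copies G j|).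
move: (#|G|%:R : R) (#|clique_copies G j|%:R : R) (#|clique_copies G j.+1|%:R : R)
  (#|clique_copies G j.+2|%:R : R) (#|nonneighbours e|%:R : R) (D%:R : R)
  (#|cliques_over (j.+2 + 2) e|%:R : R) => n c0 c1 c2 Z x k.
clear - d0 => p2 p1 n0 xd Zx Z0 p0 hu hl.
split.
- by rewrite ler_pdivrMr //; lra.
- rewrite (_ : _ - _ = (c2 - Z * c1) / c2); last by field; lra.
  by rewrite ler_wpM2r ?invr_ge0 ?(ltW p2) //; lra.
- rewrite (_ : _ + _ = (c2 - Z * c1 + 6 * (d * n) ^+ 2 * c0) / c2); last first.
    by field; lra.
  rewrite ler_wpM2r ?invr_ge0 ?(ltW p2) //.
  have : (Z * x + Z * Z) * c0 <= 6 * (d * n) ^+ 2 * c0.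
    rewrite ler_wpM2r //.
    have h1 : Z * x <= 2 * (d * n) * (d * n) by apply: ler_pM; lra.
    have h2 : Z * Z <= 2 * (d * n) * (2 * (d * n)) by apply: ler_pM; lra.
    by rewrite expr2; lra.
  lra.
Qed.

(** * The initial weighting, by extrapolation from [j] to [2 * j] *)

(* Here P and P' are the proportions of j-cliques and of 2j-cliques that avoid the
   non-neighbours of an edge; the linear terms of 2 * P - P' cancel since u is
   close to 2 * t. *)
Lemma extrapolation (R : realType) (d J z t t' u u' P P' : R) :
  0 <= d -> 1 <= J -> J ^+ 2 * d <= 1 / 10 ^+ 5 -> 0 <= z <= 2 * d ->
  J <= t -> t <= J * (1 + 2 * J * d) -> 0 <= t' -> t' <= 2 * J ->
  2 * J <= u -> u <= 2 * J * (1 + 2 * (2 * J) * d) -> 0 <= u' -> u' <= 4 * J ->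
  1 - z * t <= P -> P <= 1 - z * t + 6 * d ^+ 2 * (t * t') ->
  1 - z * u <= P' -> P' <= 1 - z * u + 6 * d ^+ 2 * (u * u') ->
  `|1 - (2 * P - P')| <= d.
Proof.
move=> d0 J1 hJ /andP[z0 zd] t1 t2 t'0 t'2 u1 u2 u'0 u'2 P1 P2 P'1 P'2.
have hJd : J ^+ 2 * d * d <= 1 / 10 ^+ 5 * d by rewrite ler_wpM2r.
have Jd0 : 0 <= J * d by rewrite mulr_ge0 //; lra.
have JJd : J * d <= J ^+ 2 * d by rewrite ler_wpM2r // expr2 ler_peMl //; lra.
have tt : t * t' <= 2 * J * (2 * J).
  apply: ler_pM => //; first lra.
  apply: le_trans t2 _; rewrite mulrC ler_wpM2r //; lra.
have uu : u * u' <= 4 * J * (4 * J).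
  apply: ler_pM => //; first lra.
  apply: le_trans u2 _.
  have : 2 * J * (1 + 2 * (2 * J) * d) <= 2 * J * 2 by rewrite ler_wpM2l //; lra.
  lra.
have hz1 : z * (u - 2 * t) <= 2 * d * (8 * J ^+ 2 * d).
  apply: (@le_trans _ _ (z * (8 * J ^+ 2 * d))).
    by rewrite ler_wpM2l //; rewrite expr2; lra.
  by rewrite ler_wpM2r // !mulr_ge0 //; lra.
have hz2 : z * (2 * t - u) <= 2 * d * (4 * J ^+ 2 * d).
  apply: (@le_trans _ _ (z * (4 * J ^+ 2 * d))).
    by rewrite ler_wpM2l //; rewrite expr2; lra.
  by rewrite ler_wpM2r // !mulr_ge0 //; lra.
have d2 : 0 <= 6 * d ^+ 2 by rewrite !mulr_ge0.
have tt' := ler_wpM2l d2 tt; have uu' := ler_wpM2l d2 uu.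
have e1 : 6 * d ^+ 2 * (2 * J * (2 * J)) = 24 * (J ^+ 2 * d * d) by ring.
have e2 : 6 * d ^+ 2 * (4 * J * (4 * J)) = 96 * (J ^+ 2 * d * d) by ring.
rewrite {}e1 in tt'; rewrite {}e2 in uu'.
(* In units of J^2 d^2 the errors total 16 + 48 on one side and 8 + 96 on the other, far below [d]
   since J^2 d is at most 1/10^5. *)
rewrite ler_norml; apply/andP; split; lra.
Qed.

(** The binomial is the number of [(j + 2)]-cliques through a fixed edge of a [(2j + 2)]-clique;
    dividing by it makes every [(2j + 2)]-clique contribute 1/c_{2j} to each of its edges. *)
Definition initial_weight (R : realType) (G : sgraph) (j : nat) (K : {set G}) : R :=
  2 / #|clique_copies G j|%:R -
  #|cliques_over (j + j + 2) K|%:R /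
    (#|clique_copies G (j + j)|%:R * 'C(j + j, j)%:R).

Definition initial_edge_sum (R : realType) (G : sgraph) (j : nat) (e : {set G}) : R :=
  2 * (#|cliques_over (j + 2) e|%:R / #|clique_copies G j|%:R) -
  #|cliques_over (j + j + 2) e|%:R / #|clique_copies G (j + j)|%:R.

Lemma initial_weight_sum (R : realType) (G : sgraph) (j : nat) (e : {set G}) :
  e \in clique_copies G 2 ->
  \sum_(K in cliques_over (j + 2) e) initial_weight R j K =
  initial_edge_sum R j e.
Proof.
move=> /card_clique ce; rewrite sumrB sumr_const -mulr_suml -natr_sum.
rewrite sum_cliques_over_cliques ce ?leq_addl // !addnK natrM invfM.
have B0 : 'C(j + j, j)%:R != 0 :> R by rewrite pnatr_eq0 -lt0n bin_gt0 leq_addr.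
rewrite /initial_edge_sum; congr (_ - _).
  by rewrite -[LHS]mulr_natr mulrAC mulrA.
by rewrite [X in X * _]mulrC mulrACA divff // mulr1.
Qed.

(** At most c_j cliques extend [K], and c_{2j} times the binomial is at least (2/3) c_j^2, so the
    subtracted term is at most (3/2)/c_j out of 2/c_j. *)
Lemma initial_weight_ge (R : realType) (G : sgraph) (D j : nat) (d : R) (K : {set G}) :
  (forall v : G, #|nonneighbours [set v]| <= D)%N ->
  (0 < #|G|)%N -> 0 <= d -> D%:R <= d * #|G|%:R -> (j + j)%:R * d <= 1 / 2 ->
  j%:R ^+ 2 * d <= 1 / 10 ^+ 5 -> (0 < j)%N -> K \in clique_copies G (j + 2) ->
  1 / (2 * #|clique_copies G j|%:R) <= initial_weight R j K.
Proof.
move=> hD n0 d0 hDd hmd hJ j0 hK.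
have hj : (0 < j <= j + j)%N by rewrite j0 leq_addr.
have hjj : (0 < j + j <= j + j)%N by rewrite addn_gt0 j0 leqnn.
have [c0 _ t2] := @clique_ratio_bounds R G D j _ d hD n0 d0 hDd hmd hj.
have [cc0 _ _] := @clique_ratio_bounds R G D (j + j) _ d hD n0 d0 hDd hmd hjj.
have hN : #|cliques_over (j + j + 2) K|%:R <= #|clique_copies G j|%:R :> R.
  by rewrite ler_nat -addnA card_cliques_over_clique_le.
have := @card_cliquesD_ge G D j j.-1 hD; rewrite (prednK j0) -(ler_nat R) natrD !natrM.
have Jd : j%:R * d <= 1 / 2.
  by apply: le_trans hmd; rewrite ler_wpM2r // ler_nat leq_addr.
have B0 : 0 < 'C(j + j, j)%:R :> R by rewrite ltr0n bin_gt0 leq_addr.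
rewrite /initial_weight; move: t2 hN; rewrite /clique_ratio ler_pdivrMr //.
have {}n0 : 0 < #|G|%:R :> R by rewrite ltr0n.
move: hDd n0 c0 cc0 B0 Jd hJ (ler0n R j) (ler0n R #|clique_copies G j.-1|) d0.
move: (#|G|%:R : R) (#|clique_copies G j|%:R : R) (#|clique_copies G (j + j)|%:R : R)
  ('C(j + j, j)%:R : R) (j%:R : R) (#|clique_copies G j.-1|%:R : R)
  (#|cliques_over (j + j + 2) K|%:R : R) (D%:R : R).
clear => n c cc B J c' N x xd n0 c0 cc0 B0 Jd hJ J0 c'0 d0 t2 hN hc.
have h1 : x * c' <= 2 * (J * d) * c.
  apply: (@le_trans _ _ (d * (n * c'))); first by rewrite mulrA ler_wpM2r.
  apply: (@le_trans _ _ (d * (J * (1 + 2 * J * d) * c))); first by rewrite ler_wpM2l.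
  have : d * J * c * (1 + 2 * J * d) <= d * J * c * 2.
    by rewrite ler_wpM2l ?mulr_ge0 ?(ltW c0) //; lra.
  lra.
have h2 : c * (J * x * c') <= c * c * (2 * (J ^+ 2 * d)).
  have : c * J * (x * c') <= c * J * (2 * (J * d) * c).
    by rewrite ler_wpM2l // mulr_ge0 // ltW.
  by rewrite expr2; lra.
have h3 : c * c * (2 * (J ^+ 2 * d)) <= c * c * (1 / 10).
  by rewrite ler_wpM2l ?mulr_ge0 ?(ltW c0) //; lra.
have h4 : 2 / 3 * (c * c) <= cc * B by have := mulr_gt0 c0 c0; lra.
have h5 : N / (cc * B) <= 3 / 2 / c.
  rewrite ler_pdivrMr ?mulr_gt0 // mulrAC ler_pdivlMr //.
  have : N * c <= c * c by rewrite ler_wpM2r // ltW.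
  lra.
have -> : 1 / (2 * c) = 2 / c - 3 / 2 / c by field; lra.
lra.
Qed.

Lemma initial_edge_sum_close (R : realType) (G : sgraph) (D j : nat) (d : R)
    (e : {set G}) :
  (forall v : G, #|nonneighbours [set v]| <= D)%N ->
  (0 < #|G|)%N -> 0 <= d -> D%:R <= d * #|G|%:R -> (j + j)%:R * d <= 1 / 2 ->
  j%:R ^+ 2 * d <= 1 / 10 ^+ 5 -> (1 < j)%N -> e \in clique_copies G 2 ->
  `|1 - initial_edge_sum R j e| <= d.
Proof.
move=> hD n0 d0 hDd hmd hJ j1 he.
have hj : (1 < j <= j + j)%N by rewrite j1 leq_addr.
have hjj : (1 < j + j <= j + j)%N by rewrite leqnn andbT ltn_addl.
have [z2 P1 P2] := @local_density R G D j _ d e hD n0 d0 hDd hmd hj he.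
have [_ P'1 P'2] := @local_density R G D (j + j) _ d e hD n0 d0 hDd hmd hjj he.
have B i (hi : (0 < i <= j + j)%N) :=
  @clique_ratio_bounds R G D i _ d hD n0 d0 hDd hmd hi.
have [b1 b2 b3 b4] : [/\ 0 < j <= j + j, 0 < j.-1 <= j + j,
    0 < j + j <= j + j & 0 < (j + j).-1 <= j + j]%N.
  by move: j1; clear; split; lia.
have [_ t1 t2] := B j b1; have [_ s1 s2] := B j.-1 b2.
have [_ u1 u2] := B (j + j)%N b3; have [_ v1 v2] := B (j + j).-1 b4.
(* The ratios at [j.-1] and [(j + j).-1] enter only the quadratic errors, so a bound within a factor
   2 suffices for them. *)
have crude i : (i <= j + j)%N -> i%:R * (1 + 2 * i%:R * d) <= 2 * i%:R :> R.
  move=> hi; rewrite mulrC ler_wpM2r //.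
  have : i%:R * d <= (j + j)%:R * d by rewrite ler_wpM2r // ler_nat.
  by move: hmd; clear; lra.
have z0 : 0 <= #|nonneighbours e|%:R / #|G|%:R :> R by rewrite divr_ge0.
have dbl : (j + j)%:R = 2 * j%:R :> R by rewrite natrD; clear; lra.
rewrite dbl in u1 u2.
apply: (extrapolation d0 _ hJ _ t1 t2 _ _ u1 u2 _ _ P1 P2 P'1 P'2).
- by rewrite ler1n ltnW.
- by rewrite z0.
- by apply: le_trans s1.
- apply: le_trans s2 _; apply: le_trans (crude _ _) _; first by case/andP: b2.
  by rewrite ler_wpM2l // ler_nat leq_pred.
- by apply: le_trans v1.
- apply: le_trans v2 _; apply: le_trans (crude _ _) _; first by case/andP: b4.
  have : (j + j).-1%:R <= (j + j)%:R :> R by rewrite ler_nat leq_pred.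
  by rewrite dbl; clear; lra.
Qed.

(** * Edge count, minimum degree and cliques through an edge *)

Lemma card_cliques0_le (G : sgraph) : (#|clique_copies G 0| <= 1)%N.
Proof.
rewrite -(cards1 (set0 : {set G})); apply: subset_leq_card; apply/subsetP => K.
by move=> /card_clique/eqP; rewrite cards_eq0 inE.
Qed.

Lemma card_edges_le (G : sgraph) : (2 * #|clique_copies G 2| <= #|G| * #|G|)%N.
Proof.
have h1 := card_cliquesS_le G 1; have h0 := card_cliquesS_le G 0.
apply: leq_trans h1 _; rewrite leq_mul2l; apply/orP; right.
rewrite mul1n in h0; apply: leq_trans h0 _.
by rewrite -[leqRHS]muln1 leq_mul2l card_cliques0_le orbT.
Qed.

Lemma min_degree_le (G : sgraph) (v : G) : (min_degree G <= degree v)%N.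
Proof.
rewrite /min_degree; elim: (index_enum G) (mem_index_enum v) => // u s ih.
by rewrite inE big_cons geq_min => /orP[/eqP->|/ih->]; rewrite ?leqnn ?orbT.
Qed.

Lemma card_nonneighbours1 (G : sgraph) (v : G) :
  #|nonneighbours [set v]| = (#|G| - degree v)%N.
Proof.
rewrite [LHS]cardsCs /degree; congr subn; apply: eq_card => u.
by rewrite in_setC in_nonneighbours1 negbK inE.
Qed.

(** The linear loss in [local_density] is at most (2d)(2r) <= 1/2. This keeps the denominators of
    the gadget amplitudes large. *)
Lemma card_cliques_over_edge_ge (R : realType) (G : sgraph) (D r : nat) (d : R)
    (e : {set G}) :
  (forall v : G, #|nonneighbours [set v]| <= D)%N ->
  (0 < #|G|)%N -> 0 <= d -> D%:R <= d * #|G|%:R -> r%:R * d <= 1 / 8 ->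
  (1 < r)%N -> e \in clique_copies G 2 ->
  0 < #|clique_copies G r|%:R / 2 :> R /\
  #|clique_copies G r|%:R / 2 <= #|cliques_over (r + 2) e|%:R :> R.
Proof.
move=> hD n0 d0 hDd rd r1 he.
have half : r%:R * d <= 1 / 2 by move: rd; clear; lra.
have b1 : (0 < r <= r)%N by rewrite leqnn ltnW.
have b2 : (1 < r <= r)%N by rewrite leqnn andbT.
have [c0 _ t2] := clique_ratio_bounds hD n0 d0 hDd half b1.
have [z2 P1 _] := local_density hD n0 d0 hDd half b2 he.
split; first by rewrite divr_gt0.
have zt : #|nonneighbours e|%:R / #|G|%:R * clique_ratio R G r <= 1 / 2.
  apply: (@le_trans _ _ (2 * d * (2 * r%:R))); last by move: rd; clear; lra.
  apply: ler_pM => //; first by rewrite divr_ge0.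
    by rewrite /clique_ratio divr_ge0 // mulr_ge0.
  apply: le_trans t2 _; rewrite mulrC ler_wpM2r //.
  by move: rd; clear; lra.
have : 1 / 2 <= #|cliques_over (r + 2) e|%:R / #|clique_copies G r|%:R :> R.
  by move: P1 zt; clear; lra.
by rewrite ler_pdivlMr // mulrC mulrA mulr1.
Qed.

(** * Nonnegativity of the corrected weighting and conclusion *)

(** With r = j + 2, amplitudes are at most 2d/c_r, so the correction is at most 12 d c_2/c_r. From 2
    c_2 <= n^2 and n^2 c_j <= 4 r^2 c_r this is at most 24 r^2 d/c_j, below the initial weight 1/(2
    c_j). *)
Lemma weight_ge0 (R : realType) (G : sgraph) (D j : nat) (d : R)
    (y : {set G} -> R) (K : {set G}) :
  (forall v : G, #|nonneighbours [set v]| <= D)%N ->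
  (0 < #|G|)%N -> 0 <= d -> D%:R <= d * #|G|%:R ->
  (j + 2)%:R ^+ 2 * d <= 1 / 10 ^+ 5 -> (2 <= j)%N -> K \in clique_copies G (j + 2) ->
  (forall e, e \in clique_copies G 2 ->
     y e = (1 - initial_edge_sum R j e) / #|cliques_over (j + 2 + 2) e|%:R) ->
  0 <= initial_weight R j K + correction (j + 2) y K.
Proof.
move=> hD n0 d0 hDd hr j2 hK hy.
have rd : (j + 2)%:R * d <= 1 / 8.
  apply: (@le_trans _ _ ((j + 2)%:R ^+ 2 * d)).
    by rewrite ler_wpM2r // expr2 ler_peMl // ler1n addn2.
  by apply: le_trans hr _; clear; lra.
have hm : (j + j + 2)%:R * d <= 1 / 4.
  have : (j + j + 2)%:R * d <= 2 * ((j + 2)%:R * d).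
    rewrite mulrA ler_wpM2r // -natrM ler_nat; clear; lia.
  by move: rd; clear; lra.
have hJ : j%:R ^+ 2 * d <= 1 / 10 ^+ 5.
  apply: le_trans hr; rewrite ler_wpM2r // -!natrX ler_nat leq_exp2r //.
  exact: leq_addr.
have half m : (m <= j + j + 2)%N -> m%:R * d <= 1 / 2.
  move=> hmj; have : m%:R * d <= (j + j + 2)%:R * d by rewrite ler_wpM2r // ler_nat.
  by move: hm; clear; lra.
have j0 := ltnW j2.
have hw := initial_weight_ge hD n0 d0 hDd (half _ (leq_addr 2 _)) hJ j0 hK.
have lej : (j + 2 <= j + j + 2)%N by rewrite leq_add2r leq_addr.
have b2 : (0 < j + 2 <= j + 2)%N by rewrite leqnn addn2.
have b1 : (0 < j.+1 <= j + 2)%N by rewrite addn2 leqnSn.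
have b0 : (0 < j <= j + 2)%N by rewrite j0 leq_addr.
have [c2 _ t2] := clique_ratio_bounds hD n0 d0 hDd (half _ lej) b2.
have [c1 _ t1] := clique_ratio_bounds hD n0 d0 hDd (half _ lej) b1.
have [c0 _ _] := clique_ratio_bounds hD n0 d0 hDd (half _ lej) b0.
have crude i : (i <= j + 2)%N -> i%:R * (1 + 2 * i%:R * d) <= 2 * (j + 2)%:R :> R.
  move=> hi; have hid : i%:R * d <= (j + 2)%:R * d by rewrite ler_wpM2r // ler_nat.
  rewrite mulrC ler_pM ?ler_nat ?addr_ge0 ?mulr_ge0 //.
  by move: rd hid; clear; lra.
have yb e : e \in clique_copies G 2 -> `|y e| <= 2 * d / #|clique_copies G (j + 2)|%:R.
  move=> he.
  have r1 : (1 < j + 2)%N by rewrite addn2.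
  have [kh kb] := card_cliques_over_edge_ge hD n0 d0 hDd rd r1 he.
  have he1 : `|1 - initial_edge_sum R j e| <= d.
    exact: (initial_edge_sum_close hD n0 d0 hDd (half _ (leq_addr 2 _)) hJ j2 he).
  have k0 : 0 < #|cliques_over (j + 2 + 2) e|%:R :> R.
    exact: lt_le_trans kb.
  rewrite hy // normrM normfV [X in _ / X]gtr0_norm // ler_pdivrMr //.
  apply: le_trans he1 _; rewrite mulrAC ler_pdivlMr //.
  have := ler_wpM2l d0 kb; move: d0; clear; lra.
have bb0 : 0 <= 2 * d / #|clique_copies G (j + 2)|%:R by rewrite divr_ge0 ?mulr_ge0.
have hr4 : (4 <= j + 2)%N by rewrite addn2.
have hc := correction_bound hr4 hK yb bb0.
suff hs : 2 * d / #|clique_copies G (j + 2)|%:R * 6 * #|clique_copies G 2|%:R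
    <= 1 / (2 * #|clique_copies G j|%:R).
  by have := ler_norm (- correction (j + 2) y K); rewrite normrN; move: hc hs hw; clear; lra.
have := card_edges_le G; rewrite -(ler_nat R) !natrM => hE.
have jE : (j + 2).-1 = j.+1 by rewrite addn2.
have /andP[_ le1] := b1.
move: (le_trans t1 (crude _ le1)) (le_trans t2 (crude _ (leqnn _))).
rewrite /clique_ratio !ler_pdivrMr // jE /=.
have {}n0 : 0 < #|G|%:R :> R by rewrite ltr0n.
move: hE n0 c0 c1 c2 hr (ler0n R (j + 2)) d0.
move: (#|G|%:R : R) (#|clique_copies G 2|%:R : R) (#|clique_copies G j|%:R : R)
  (#|clique_copies G j.+1|%:R : R) (#|clique_copies G (j + 2)|%:R : R) ((j + 2)%:R : R).
clear => n E a b c x hE n0 a0 b0 c0 hx x0 d0 h1 h2.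
(* Chains the ratio bounds at j + 1 and j + 2, each at most 2r. *)
have h3 : n * n * a <= 4 * x ^+ 2 * c.
  apply: (@le_trans _ _ (2 * x * (n * b))).
    have := ler_wpM2l (ltW n0) h1; lra.
  have := ler_wpM2l (_ : 0 <= 2 * x) h2; rewrite expr2 mulr_ge0 // => /(_ isT); lra.
rewrite ler_pdivlMr ?mulr_gt0 //.
have -> : 2 * d / c * 6 * E * (2 * a) = 24 * d * E * a / c by field; lra.
rewrite ler_pdivrMr //.
have h4 : d * (2 * E * a) <= d * (4 * x ^+ 2 * c).
  by rewrite ler_wpM2l //; apply: le_trans h3; rewrite ler_wpM2r ?(ltW a0).
have h5 : x ^+ 2 * d * c <= 1 / 10 ^+ 5 * c by rewrite ler_wpM2r // ltW.
lra.
Qed.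

(** The bound [w K <= 1] follows because [K] contains an edge, and [w K] is one of the nonnegative
    terms summing to 1 there. *)
Lemma fractional_decomposition_of_ge0 (R : realType) (G : sgraph) (r : nat)
    (w : {set G} -> R) :
  (2 <= r)%N ->
  (forall K, K \in clique_copies G r -> 0 <= w K) ->
  (forall e, e \in edges G ->
     \sum_(K in clique_copies G r | e \subset K) w K = 1) ->
  fractional_clique_decomposition r w.
Proof.
move=> r2 w0 w1; split=> // K hK; rewrite w0 //=.
have [x [y [xK yK nxy]]] : exists x y, [/\ x \in K, y \in K & x != y].
  by apply/card_gt1P; rewrite (card_clique hK).
have sK : [set x; y] \subset K by rewrite subUset !sub1set xK.
have he : [set x; y] \in edges G.
  by rewrite edges_clique; have := clique_sub hK sK; rewrite cards2 nxy.
rewrite -(w1 _ he) (bigD1 K) ?hK //= lerDl.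
by apply: sumr_ge0 => L /andP[/andP[hL _] _]; apply: w0.
Qed.

Theorem theorem6p1 (R : realType) (r : nat) (G : sgraph)
    (hr : (4 <= r)%N)
    (hn : (10 ^ 6 * r ^ 4 <= #|G|)%N)
    (hdelta : (1 - 1 / (10 ^+ 5 * r%:R ^+ 2)) * #|G|%:R
                <= (min_degree G)%:R :> R) :
  exists w : {set G} -> R, fractional_clique_decomposition r w.
Proof.
have n0 : (0 < #|G|)%N.
  apply: leq_trans hn; rewrite muln_gt0 !expn_gt0 /=.
  by apply/orP; left; apply: leq_trans hr.
pose D := (#|G| - min_degree G)%N.
have hD (v : G) : (#|nonneighbours [set v]| <= D)%N.
  by rewrite card_nonneighbours1 leq_sub2l // min_degree_le.
(* A vertex witnesses [min_degree G <= #|G|], so the truncated subtraction in [D] is exact. *)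
have [v _] : exists v : G, v \in G by apply/card_gt0P.
have hDd : D%:R <= 1 / (10 ^+ 5 * r%:R ^+ 2) * #|G|%:R :> R.
  rewrite natrB; last by apply: leq_trans (min_degree_le v) _; apply: max_card.
  by move: hdelta; clear; lra.
have r0 : 0 < r%:R :> R by rewrite ltr0n; apply: leq_trans hr.
have [d0 hd] : 0 <= 1 / (10 ^+ 5 * r%:R ^+ 2) :> R /\
    r%:R ^+ 2 * (1 / (10 ^+ 5 * r%:R ^+ 2)) <= 1 / 10 ^+ 5 :> R.
  split; first by rewrite divr_ge0 ?mulr_ge0 ?exprn_ge0 ?ltW.
  rewrite le_eqVlt; apply/orP; left; apply/eqP.
  have p0 : 10 ^+ 5 != 0 :> R by rewrite expf_neq0 // pnatr_eq0.
  by field; rewrite (gt_eqF r0).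
move: hDd d0 hd; move: (1 / _ : R) => d hDd d0 hd.
have [j rE] : exists j, r = (j + 2)%N by exists (r - 2)%N; rewrite subnK // ltnW // ltnW.
have j2 : (2 <= j)%N by rewrite -(leq_add2r 2) -rE.
rewrite {}rE in hr hd *.
(* The deficit at [e] is shared equally among the [(r + 2)]-cliques through [e]; [correction_sum]
   multiplies by their number and restores it exactly. *)
pose y (e : {set G}) : R :=
  (1 - initial_edge_sum R j e) / #|cliques_over (j + 2 + 2) e|%:R.
exists (fun K => initial_weight R j K + correction (j + 2) y K).
apply: fractional_decomposition_of_ge0 => [|K hK|e]; first exact: leq_addl.
  exact: (weight_ge0 hD n0 d0 hDd hd j2 hK).
rewrite edges_clique => he.
rewrite (eq_bigl (fun K => K \in cliques_over (j + 2) e)) => [|K]; last by rewrite [RHS]inE.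
rewrite big_split /= initial_weight_sum // correction_sum // /y.
have rd : (j + 2)%:R * d <= 1 / 8.
  apply: (@le_trans _ _ ((j + 2)%:R ^+ 2 * d)).
    by rewrite ler_wpM2r // expr2 ler_peMl // ler1n addn2.
  by apply: le_trans hd _; clear; lra.
have r1 : (1 < j + 2)%N by rewrite addn2.
have [kh kb] := card_cliques_over_edge_ge hD n0 d0 hDd rd r1 he.
by rewrite divfK ?gt_eqF ?(lt_le_trans kh) // addrC subrK.
Qed.
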